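(* Let $\kappa:[0,1]\to\mathbb R$ be continuous, nondecreasing and concave with $\kappa(0)=0$, $\kappa(1)=1$, and let $\mathcal S$ be the multiplicative monoid generated by pairwise coprime integers $N_1,\dots,N_s\ge2$, $s\ge1$. An $\mathcal S$-invariant ergodic measure $\mu\in M^+(\mathbb T)$ with $\mu(F)>0$ for some $\kappa$-Carleson set $F$ is $\kappa$-thin.
   Context: $\mathbb T$ is the unit circle, $\lambda$ its Haar probability measure, $|I|=\lambda(I)$ for arcs $I$. $M^+(\mathbb T)$ is the set of finite positive Borel measures on $\mathbb T$. $N\in\mathcal S$ acts on $\mathbb T$ by $\varphi_N(\zeta)=\zeta^N$; $\mu$ is $\mathcal S$-invariant if $(\varphi_N)_*\mu=\mu$ for all $N\in\mathcal S$, and ergodic (for the $\mathcal S$-action) if every Borel set $B$ with $\varphi_N^{-1}(B)=B$ for all $N\in\mathcal S$ satisfies $\mu(B)=0$ or $\mu(B)=\mu(\mathbb T)$. The $\kappa$-entropy of a finite set $\emptyset\ne E\subset\mathbb T$ is $\kappa(E)=\sum_I\kappa(|I|)$ over the connected components $I$ of $\mathbb T\setminus E$; $\kappa(\emptyset)=0$; for closed $\emptyset\ne E\subset\mathbb T$, $\kappa(E)=\sup\{\kappa(E_1):E_1\subset E\text{ finite}\}$. A $\kappa$-Carleson set is a closed $E\subset\mathbb T$ with $\lambda(E)=0$ and $\kappa(E)<\infty$; $\mathcal F_\kappa$ denotes the set of these. A positive (possibly infinite) Borel measure $\mu$ on $\mathbb T$ is $\kappa$-thin if (i) there is a sequence $F_1\subset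 F_2\subset\cdots$ in $\mathcal F_\kappa$ with $\mu(B)=\lim_{\nu\to\infty}\mu(B\cap F_\nu)$ for every Borel set $B\subset\mathbb T$, and (ii) there is $c\ge0$ with $\mu(F)\le c\,\kappa(F)$ for all $F\in\mathcal F_\kappa$. *)

(* Defs.v *)
From HB Require Import structures.
From mathcomp Require Import all_boot all_order all_algebra.
From mathcomp Require Import complex.
From mathcomp Require Import all_classical all_reals all_analysis.
From mathcomp Require Import measurable_realfun.

Set Implicit Arguments.
Unset Strict Implicit.
Unset Printing Implicit Defensive.

Import Order.TTheory GRing.Theory Num.Theory.
Import numFieldNormedType.Exports numFieldTopology.Exports.

Local Open Scope classical_set_scope.
Local Open Scope ring_scope.
Local Open Scope complex_scope.

Definition unit_circle (R : realType) : set R[i]^o := [set z | `|z| = 1].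

(* As a [set_type], the circle carries the topology induced by [R[i]]. *)
Definition circle (R : realType) : Type := set_type (@unit_circle R).

Section circle_structure.
Variable R : realType.
Implicit Types z w : circle R.

HB.instance Definition _ := Choice.on (circle R).
HB.instance Definition _ := Topological.on (circle R).

Lemma unit_circle1 : (1 : R[i]^o) \in @unit_circle R.
Proof. by rewrite inE /unit_circle /= normr1. Qed.

HB.instance Definition _ := isPointed.Build (circle R) (SigSub unit_circle1).

(* Borel sigma-algebra. *)
HB.instance Definition _ := @isMeasurable.Build
  (sigma_display (@open (circle R))) (circle R) <<s @open (circle R) >>
  (@sigma_algebra0 _ setT _) (@sigma_algebraC _ _) (@sigma_algebra_bigcup _ setT _).

Lemma unit_circleX z n : (sval z : R[i]) ^+ n \in @unit_circle R.
Proof.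
by rewrite inE /unit_circle /= normrX; case: z => z /= /set_mem ->; rewrite expr1n.
Qed.

Definition circle_pow (n : nat) z : circle R := SigSub (unit_circleX z n).

Lemma unit_circle_cis (x : R) :
  (cos x +i* sin x : R[i]^o) \in @unit_circle R.
Proof.
rewrite inE /unit_circle /= normc_def /= cos2Dsin2 sqrtr1.
by [].
Qed.

Definition circle_exp (t : R) : circle R :=
  SigSub (unit_circle_cis (2 * pi * t)).

Lemma continuous_circle_exp : continuous circle_exp.
Proof.
have cC (f : R -> R) : continuous f -> continuous (fun t => (f t)%:C : R[i]^o).
  move=> cf t; apply/(@cvgrPdist_lt _ R[i]^o) => e e0.
  have ee : e = (complex.Re e)%:C by apply/esym/RRe_real/gtr0_real.
  have /cvgrPdist_lt/(_ (complex.Re e)) := cf t.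
  rewrite -ltcR -ee => /(_ e0); apply: filterS => u.
  rewrite -ltcR -ee; apply: le_lt_trans.
  by rewrite -rmorphB normc_def/= expr0n/= addr0 sqrtr_sqr.
apply: continuous_comp_initial => t.
rewrite (_ : _ \o _ = fun u => ((cos (2 * pi * u))%:C : R[i]^o) +
    ('i : R[i]^o) * ((sin (2 * pi * u))%:C : R[i]^o)); last first.
  by apply/funext => u /=; rewrite [LHS]complexE.
have cl : continuous (fun u : R => 2 * pi * u).
  by move=> u; apply: cvgM; [exact: cvg_cst|exact: cvg_id].
apply: (@cvgD _ R[i]^o).
  apply: (cC (fun u => cos (2 * pi * u))) => u.
  by apply: continuous_comp; [exact: cl|exact: continuous_cos].
apply: (@cvgM R[i]); first exact: cvg_cst.
apply: (cC (fun u => sin (2 * pi * u))) => u.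
by apply: continuous_comp; [exact: cl|exact: continuous_sin].
Qed.

Lemma measurable_circle_exp : measurable_fun setT circle_exp.
Proof.
apply: (@measurability _ _ _ _ setT circle_exp (@open (circle R))) => //.
move=> _ [U oU <-]; rewrite setTI; apply: open_measurable.
by move/continuousP : continuous_circle_exp; exact.
Qed.

(* Haar measure on the circle, i.e. normalized arc length. *)
Definition haar : set (circle R) -> \bar R :=
  pushforward (mrestr (@lebesgue_measure R) (measurable_itv `[0, 1[)) circle_exp.

HB.instance Definition _ := Measure.copy haar
  (measure_function_pushforward__canonical__measure_function_Measure
    (mrestr (@lebesgue_measure R) (measurable_itv `[0, 1[))
    measurable_circle_exp).


Lemma haar_setT : haar setT = 1%E.
Proof.
rewrite /haar /pushforward /mrestr preimage_setT setTI.
by rewrite lebesgue_measure_itv/= lte_fin ltr01 sube0.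
Qed.

HB.instance Definition _ := Measure_isProbability.Build _ _ _ haar haar_setT.

Lemma unit_circleM z w : (sval z : R[i]) * sval w \in @unit_circle R.
Proof.
rewrite inE /unit_circle /= normrM.
by case: z w => z /= /set_mem -> [w /= /set_mem ->]; rewrite mulr1.
Qed.

Definition circle_mul z w : circle R := SigSub (unit_circleM z w).

Lemma circle_expD s t :
  circle_exp (s + t) = circle_mul (circle_exp s) (circle_exp t).
Proof.
apply/val_inj => /=; apply/eqP; rewrite mulrDr cosD sinD eq_complex /=.
by rewrite eqxx /= addrC.
Qed.

Lemma circle_exp_per t : circle_exp (t + 1) = circle_exp t.
Proof.
by apply/val_inj; rewrite /= mulrDr mulr1 mulr_natl cosD2pi sinD2pi.
Qed.

Lemma circle_exp_surj z : exists2 t, 0 <= t <= 1 & z = circle_exp t.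
Proof.
have [z0 p0 pi20] : [/\ 0 <= pi :> R, 0 < pi :> R & 2 * pi != 0 :> R].
  by split; rewrite ?pi_ge0 ?pi_gt0 // mulf_neq0 ?gt_eqF ?pi_gt0.
case: z => [[a b] zU]; have := set_mem zU; rewrite /unit_circle /= normc_def.
move=> /(congr1 (@complex.Re R)) /= ab1.
have {}ab1 : a ^+ 2 + b ^+ 2 = 1.
  by rewrite -[LHS]sqr_sqrtr ?addr_ge0 ?sqr_ge0 // ab1 expr1n.
have a1 : -1 <= a <= 1.
  by rewrite -ler_norml -[leRHS]sqrtr1 -sqrtr_sqr ler_wsqrtr // -ab1 lerDl sqr_ge0.
have sb : sin (acos a) = `|b| by rewrite sin_acos // -ab1 addrC addKr sqrtr_sqr.
have ca : cos (acos a) = a by rewrite acosK // in_itv.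
have [ac0 acpi] := (acos_ge0 a1, acos_lepi a1).
have t0 : 0 <= acos a / (2 * pi) by rewrite divr_ge0 // mulr_ge0.
have t1 : acos a / (2 * pi) <= 1.
  by rewrite ler_pdivrMr ?mulr_gt0 // mul1r (le_trans acpi) // ler_peMl // ler1n.
have [b0|b0] := leP 0 b.
  exists (acos a / (2 * pi)); first by rewrite t0.
  by apply/val_inj; rewrite /= [2 * pi * _]mulrC divfK // ca sb ger0_norm.
exists (1 - acos a / (2 * pi)); first by rewrite subr_ge0 t1 gerBl.
apply/val_inj; rewrite /= mulrBr mulr1 [2 * pi * (_ / _)]mulrC divfK // addrC.
by rewrite mulr_natl cosD2pi sinD2pi cosN sinN ca sb ltr0_norm // opprK.
Qed.

Lemma lebesgue_measureD a (A : set (measurableTypeR R)) : measurable A ->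
  @lebesgue_measure R (+%R a @^-1` A) = @lebesgue_measure R A.
Proof.
move=> mA.
have mD : measurable_fun setT (+%R a : measurableTypeR R -> measurableTypeR R).
  by apply: measurable_funD => //; exact: measurable_cst.
pose nu := measure_function_pushforward__canonical__measure_function_Measure
  (@lebesgue_measure R) mD.
suff nuE X : ocitv X -> lebesgue_measure X = nu X.
  by rewrite [RHS](lebesgue_measure_unique nuE).
move=> [[x y]] _ <- /=; rewrite /pushforward.
rewrite (_ : _ @^-1` _ = `]x - a, y - a]%classic); last first.
  by apply/seteqP; split => t /=; rewrite !in_itv /= ltrBlDl lerBrDl.
rewrite !lebesgue_measure_itv /= !lte_fin ltrD2r.
by case: ifPn => // _; rewrite -!EFinD opprB addrA subrK.
Qed.

(* Rotation invariance, which characterizes [haar] among probabilities. *)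
Lemma haar_rotation w (A : set (circle R)) :
  measurable A -> haar (circle_mul w @^-1` A) = haar A.
Proof.
move=> mA; have [a /andP[a0 a1] ->] := circle_exp_surj w.
rewrite /haar /pushforward /mrestr.
set P : set (measurableTypeR R) := circle_exp @^-1` A.
have mP : measurable P by rewrite -[P]setTI; exact: measurable_circle_exp.
have PD t : P (1 + t) = P t by rewrite addrC /P /= circle_exp_per.
have mI b c (x y : R) :
  measurable ([set` Interval (BSide b x) (BSide c y)] : set (measurableTypeR R)).
  exact: measurable_itv.
transitivity (lebesgue_measure (P `&` `[a, a + 1[)).
  rewrite -(lebesgue_measureD a (measurableI _ _ mP (mI _ _ _ _))).
  congr (lebesgue_measure _); rewrite preimage_setI; congr (_ `&` _).
    by apply/funext => t; rewrite /P /= circle_expD.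
  by apply/seteqP; split => t /=; rewrite !in_itv /= lerDl ltrD2l.
have split_itv (x y z : R) : x <= y -> y <= z ->
    lebesgue_measure (P `&` `[x, z[) =
    (lebesgue_measure (P `&` `[x, y[) + lebesgue_measure (P `&` `[y, z[))%E.
  move=> xy yz; rewrite -measureU; first last.
  - rewrite setIACA setIid (_ : `[x, y[ `&` _ = set0) ?setI0 //.
    apply/seteqP; split => t //= -[]; rewrite !in_itv /= => /andP[_ ty] /andP[yt].
    by rewrite ltNge yt in ty.
  - exact: measurableI.
  - exact: measurableI.
  by rewrite -setIUr -itv_bndbnd_setU.
rewrite (@split_itv a 1) ?lerDr // (@split_itv 0 a 1) // addeC; congr (_ + _)%E.
rewrite -(lebesgue_measureD 1 (measurableI _ _ mP (mI _ _ _ _))).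
congr (lebesgue_measure _); rewrite preimage_setI; congr (_ `&` _).
  by apply/funext => t; rewrite -[RHS]PD.
by apply/seteqP; split => t /=; rewrite !in_itv /= lerDl [a + 1]addrC ltrD2l.
Qed.

End circle_structure.
Arguments circle_pow {R} n z.
Arguments haar {R}.

Section entropy.
Variables (R : realType) (kappa : R -> R).
Implicit Types E : set (circle R).

Definition components (T : topologicalType) (A : set T) : set (set T) :=
  [set connected_component A x | x in A].

(* [kappa] is meant as a function on [0, 1], the range of [haar]. It will be
   nonnegative there, so that the [esum] below is the plain sum; the index set is
   finite when [E] is. *)
Definition entropy_finite E : \bar R :=
  if `[< E = set0 >] then 0%E
  else \esum_(I in components (~` E)) (kappa (fine (haar I)))%:E.

(* For a closed set [E]; the value at [set0] is 0. *)
Definition entropy E : \bar R :=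
  ereal_sup [set entropy_finite E1 | E1 in
    [set E1 | finite_set E1 /\ E1 `<=` E]].

Definition carleson E := [/\ closed E, haar E = 0%E & (entropy E < +oo)%E].

(* [mu] may take the value +oo. *)
Definition thin (mu : {measure set (circle R) -> \bar R}) :=
  (exists F : nat -> set (circle R),
    [/\ forall n, carleson (F n), forall n, F n `<=` F n.+1 &
        forall B, measurable B ->
          mu (B `&` F n) @[n --> \oo] --> mu B]) /\
  (exists2 c : R, 0 <= c &
    forall F, carleson F -> (mu F <= c%:E * entropy F)%E).

End entropy.

Section dynamics.
Variables (R : realType) (S : set nat) (mu : {measure set (circle R) -> \bar R}).

Definition invariant_measure := forall n, S n ->
  forall A, measurable A -> pushforward mu (circle_pow n) A = mu A.

Definition ergodic_measure := forall B, measurable B ->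
  (forall n, S n -> circle_pow n @^-1` B = B) -> mu B = 0%E \/ mu B = mu setT.

End dynamics.

Definition mul_submonoid (A : set nat) :=
  A 1%N /\ forall m n, A m -> A n -> A (m * n)%N.

Definition generated_monoid (G : set nat) : set nat := smallest mul_submonoid G.

(* Main.v *)
Require Import Defs.
From mathcomp Require Import all_boot all_order all_algebra.
From mathcomp Require Import complex.
From mathcomp Require Import all_classical all_reals all_analysis.
From mathcomp Require Import measurable_realfun ring lra.

Set Implicit Arguments.
Unset Strict Implicit.
Unset Printing Implicit Defensive.

Import Order.TTheory GRing.Theory Num.Theory.
Import numFieldNormedType.Exports.

Local Open Scope classical_set_scope.
Local Open Scope ring_scope.

(* The measure bound in thinness is cheap: a nonempty set has entropy at least
   that of a point, kappa 1 = 1, so c = mu(T) works. The point is to exhaust mu by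
   Carleson sets. Let mu F > 0 with F Carleson and let G be the union of the
   preimages phi_n^-1 F, n in S. Then phi_k^-1 G is contained in G and has the
   same measure, so the intersection C of all phi_k^-1 G agrees with G up to a
   null set, while being exactly invariant; by ergodicity G has full measure.

   It remains that preimages and finite unions of Carleson sets are Carleson.
   Cutting the circle open at 1, the entropy of a finite set is, up to the one arc
   through 1, the sum of kappa over the gaps between consecutive arguments in
   [0, 1[. Attributing each gap to its left end shows that boundedness of such
   sums passes to finite unions, and the arguments of phi_n^-1 F form n copies of
   those of F contracted by 1/n, which has smaller gaps. *)

(** * Gap sums of finite sequences in the unit interval *)

Section gap_sums.
Variables (R : realType) (kappa : R -> R).
Hypothesis kappa_homo : {in `[0, 1] &, {homo kappa : x y / x <= y}}.
Hypotheses (kappa0 : kappa 0 = 0) (kappa1 : kappa 1 = 1).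
Implicit Types (A B : set R) (t : seq R).

Lemma kappa_ge0 x : 0 <= x <= 1 -> 0 <= kappa x.
Proof.
move=> x01; have /andP[x0 _] := x01.
by rewrite -kappa0 kappa_homo // !in_itv /= ?lexx ?ler01.
Qed.

Lemma kappa_le1 x : 0 <= x <= 1 -> kappa x <= 1.
Proof.
move=> x01; have /andP[_ x1] := x01.
by rewrite -kappa1 kappa_homo // !in_itv /= ?lexx ?ler01.
Qed.

Definition gap_sum t : R := \sum_(i < (size t).-1) kappa (t`_i.+1 - t`_i).

Lemma gap_sum_cons2 x y t : gap_sum [:: x, y & t] = kappa (y - x) + gap_sum (y :: t).
Proof. by rewrite /gap_sum /= big_ord_recl. Qed.

Lemma gap_sum1 x : gap_sum [:: x] = 0.
Proof. by rewrite /gap_sum big_ord0. Qed.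

(* A gap of [t] with left end satisfying [p] is contained in the gap of the
   filtered sequence with the same left end; the latter is missing for at most
   one such left end, which the [+ 1] pays for. *)
Lemma gap_sum_filter (p : pred R) t : sorted <%R t ->
  (forall x, x \in t -> 0 <= x <= 1) ->
  \sum_(i < (size t).-1 | p t`_i) kappa (t`_i.+1 - t`_i) <=
  gap_sum [seq x <- t | p x] + 1.
Proof.
elim: t => [_ _|x [|y t] IH st t01].
- by rewrite big_ord0 /gap_sum big_ord0 add0r ler01.
- by rewrite big_ord0 /=; case: (p x); rewrite /gap_sum /= big_ord0 add0r ler01.
have /andP[xy syt] : (x < y) && path <%R y t by [].
have {}IH := IH syt (fun z zt => t01 z (mem_behead (zt : z \in behead (x :: y :: t)))).
rewrite big_mkcond big_ord_recl -big_mkcond /=.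
have {}IH : \sum_(i < size t | p (y :: t)`_i) kappa (t`_i - (y :: t)`_i)
    <= gap_sum [seq x <- y :: t | p x] + 1 by exact: IH.
case: ifPn => px; last by rewrite add0r.
have x01 : 0 <= x <= 1 by apply: t01; rewrite mem_head.
have y01 : 0 <= y <= 1 by apply: t01; rewrite !inE eqxx orbT.
case E : [seq x <- y :: t | p x] IH => [|z f] IH.
  rewrite big1; last first.
    move=> i pi; have : (y :: t)`_i \in [seq x <- y :: t | p x].
      by rewrite mem_filter pi mem_nth //= ltnS ltnW.
    by rewrite E.
  rewrite /= in E; rewrite E addr0 gap_sum1 add0r kappa_le1 //.
  by lra.
rewrite /= in E; rewrite E gap_sum_cons2 -addrA lerD //.
have zt : z \in y :: t.
  have : z \in [seq x <- y :: t | p x] by rewrite /= E mem_head.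
  by rewrite mem_filter => /andP[].
have z01 : 0 <= z <= 1 by apply: t01; rewrite inE zt orbT.
have yz : y <= z.
  move: zt; rewrite inE => /orP[/eqP -> //|zt].
  by have /allP/(_ _ zt)/ltW := order_path_min lt_trans syt.
by rewrite kappa_homo ?lerB // !in_itv /=; lra.
Qed.

(** Real-line counterpart of finite entropy; [entropy_ltyP] makes the link. *)
Definition gap_bounded A : Prop := exists C, forall t, sorted <%R t ->
  (forall x, x \in t -> A x) -> gap_sum t <= C.

Lemma gap_boundedS A B : A `<=` B -> gap_bounded B -> gap_bounded A.
Proof.
by move=> AB [C HC]; exists C => t st tA; apply: HC => // x xt; apply/AB/tA.
Qed.

Lemma gap_bounded0 : gap_bounded set0.
Proof.
exists 0 => -[|x t] _ H; first by rewrite /gap_sum big_ord0.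
by case: (H x); rewrite mem_head.
Qed.

(** Gaps with left end in [A] are controlled by the subsequence in [A], the others by the
    subsequence outside [A], which lies in [B]. Each use of [gap_sum_filter] costs 1. *)
Lemma gap_boundedU A B : A `|` B `<=` `[0, 1] ->
  gap_bounded A -> gap_bounded B -> gap_bounded (A `|` B).
Proof.
move=> AB01 [C HC] [D HD]; exists (C + 1 + (D + 1)) => t st tAB.
have t01 x : x \in t -> 0 <= x <= 1 by move=> /tAB /AB01; rewrite /= in_itv.
pose p : pred R := fun x => `[< A x >].
have pA : gap_sum [seq x <- t | p x] <= C.
  apply: HC; first exact: (sorted_filter lt_trans).
  by move=> x; rewrite mem_filter => /andP[/asboolP].
have pB : gap_sum [seq x <- t | predC p x] <= D.
  apply: HD; first exact: (sorted_filter lt_trans).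
  by move=> x; rewrite mem_filter => /andP[/= /asboolPn nA /tAB[/nA|]].
rewrite /gap_sum (bigID (fun i : 'I__ => p t`_i)) /=; apply: lerD.
  by apply: le_trans (gap_sum_filter p st t01) _; rewrite lerD2r.
by apply: le_trans (gap_sum_filter (predC p) st t01) _; rewrite lerD2r.
Qed.

Lemma gap_bounded_bigcup (A : nat -> set R) n : (forall j, A j `<=` `[0, 1]) ->
  (forall j, (j < n)%N -> gap_bounded (A j)) -> gap_bounded (\bigcup_(j < n) A j).
Proof.
move=> A01; elim: n => [_|n IH HA].
  by apply: gap_boundedS gap_bounded0 => x [].
apply: (@gap_boundedS _ ((\bigcup_(j < n) A j) `|` A n)).
  move=> x [j /=]; rewrite ltnS leq_eqVlt => /orP[/eqP -> Ax|jn Ax]; first by right.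
  by left; exists j.
apply: gap_boundedU.
- by move=> x [[j _]|]; exact: A01.
- by apply: IH => j jn; apply: HA; rewrite ltnS ltnW.
- exact: HA.
Qed.

(** The map [a * x - b] carries a sequence in the preimage to one in [A] and stretches its gaps by
    [a >= 1], so they can only gain under [kappa]. The stretched gaps join points of [[0, 1]], hence
    stay where [kappa] is monotone. *)
Lemma gap_bounded_affine A (a b : R) : 1 <= a -> A `<=` `[0, 1] ->
  gap_bounded A -> gap_bounded [set x | A (a * x - b)].
Proof.
move=> a1 A01 [C HC]; exists C => t st tA.
pose f x := a * x - b; have a0 : 0 < a by exact: lt_le_trans a1.
have sft : sorted <%R (map f t).
  by apply: homo_sorted st => x y; rewrite ltrD2r ltr_pM2l.
apply: le_trans (HC _ sft _); last by move=> _ /mapP[x xt ->]; exact: tA.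
rewrite /gap_sum size_map; apply: ler_sum => i _.
have iS : (i.+1 < size t)%N by rewrite -ltn_predRL.
have tS := tA _ (mem_nth 0 iS); have ti := tA _ (mem_nth 0 (ltnW iS)).
move/A01: (tS); move/A01: (ti); rewrite /= !in_itv /= => ti01 tS01.
have lt : t`_i < t`_i.+1 by apply/(sortedP 0 st).
have le : t`_i.+1 - t`_i <= a * (t`_i.+1 - t`_i) by rewrite ler_peMl // subr_ge0 ltW.
rewrite !(nth_map 0) ?(ltnW iS) // /f opprB addrA subrK -mulrBr.
by rewrite kappa_homo // !in_itv /=; nra.
Qed.

End gap_sums.

(** * Powers, arguments and arcs on the circle *)

Section circle_topology.
Variable R : realType.
Implicit Types (z w : circle R) (F : set (circle R)).

Lemma continuous_circle_val : continuous (fun z => sval z : R[i]^o).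
Proof. exact: initial_continuous. Qed.

Lemma circle_hausdorff : hausdorff_space (circle R).
Proof.
move=> z w zw; apply/val_inj; apply: (@norm_hausdorff _ R[i]^o) => A B Az Bw.
have [u [Au Bu]] := zw _ _ (continuous_circle_val Az) (continuous_circle_val Bw).
by exists (sval u).
Qed.

Lemma continuous_complexX n : continuous (fun x : R[i]^o => (x : R[i]) ^+ n : R[i]^o).
Proof.
elim: n => [|n IH] x; first exact: cst_continuous.
rewrite (_ : (fun _ => _) = fun y : R[i]^o => (y : R[i]) * (y : R[i]) ^+ n).
  have idx : (fun y : R[i]^o => y) @ x --> x by [].
  exact: (cvgM idx (IH x)).
by apply/funext => y; rewrite exprS.
Qed.

Lemma continuous_circle_pow n : continuous (@circle_pow R n).
Proof.
apply: continuous_comp_initial => z.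
apply: (@continuous_comp _ _ _ (fun w : circle R => sval w : R[i]^o)
  (fun x : R[i]^o => (x : R[i]) ^+ n : R[i]^o)).
- exact: continuous_circle_val.
- exact: continuous_complexX.
Qed.

Lemma measurable_circle_pow n : measurable_fun setT (@circle_pow R n).
Proof.
apply: (@measurability _ _ _ _ setT (@circle_pow R n) (@open (circle R))) => //.
move=> _ [U oU <-]; rewrite setTI; apply: sub_sigma_algebra.
by move/continuousP : (@continuous_circle_pow n); exact.
Qed.

Lemma open_measurable_circle F : open F -> measurable F.
Proof. exact: sub_sigma_algebra. Qed.

Lemma closed_measurable_circle F : closed F -> measurable F.
Proof.
move=> /closed_openC oF; rewrite -[F]setCK.
by apply: measurableC; exact: open_measurable_circle.
Qed.

Lemma circle_powM m n z : circle_pow (m * n) z = circle_pow n (circle_pow m z).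
Proof. by apply/val_inj; rewrite /= exprM. Qed.

Lemma circle_pow_exp n (t : R) : circle_pow n (circle_exp t) = circle_exp (n%:R * t).
Proof.
elim: n => [|n IH]; first by apply/val_inj; rewrite /= mul0r mulr0 cos0 sin0.
rewrite -natr1 mulrDl mul1r addrC circle_expD -IH.
by apply/val_inj; rewrite /= exprS.
Qed.

Lemma circle_expDn (t : R) n : circle_exp (t + n%:R) = circle_exp t.
Proof.
elim: n => [|n IH]; first by rewrite addr0.
by rewrite -natr1 addrA circle_exp_per.
Qed.

Lemma circle_expBn (t : R) n : circle_exp (t - n%:R) = circle_exp t.
Proof. by rewrite -[in RHS](subrK n%:R t) circle_expDn. Qed.

(** Equal images give [cos (2 * (pi * (t - s))) = 1], so [sin (pi * (t - s))] vanishes by the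
    double-angle formula; for [0 < t - s < 1] that sine is positive. *)
Lemma circle_exp_inj (s t : R) : `|s - t| < 1 ->
  circle_exp s = circle_exp t -> s = t.
Proof.
wlog lest : s t / s <= t.
  move=> H; have [|/ltW ts] := leP s t; first exact: H.
  by move=> st e; apply/esym/H; rewrite // distrC.
rewrite distrC ger0_norm ?subr_ge0 // => st1 /(congr1 val) /= [cst sst].
apply/eqP; rewrite eq_le lest /= leNgt; apply/negP => lt_st.
have c1 : cos (2 * (pi * (t - s))) = 1 :> R.
  rewrite mulrA mulrBr cosB -cst -sst -!expr2 cos2Dsin2; exact: erefl.
have := cos_mulr2n (pi * (t - s)); rewrite -[X in cos X = _]mulr_natl c1 => c2.
have s0 : 0 < sin (pi * (t - s)).
  apply: sin_gt0_pi; have p0 := pi_gt0 R.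
  by rewrite mulr_gt0 ?subr_gt0 // gtr_pMr.
have := cos2Dsin2 (pi * (t - s)); move: c2 s0; rewrite mulr2n; nra.
Qed.

Lemma circle_exp_surj_itv (a : R) z : exists2 t, a <= t < a + 1 & z = circle_exp t.
Proof.
have [t _ ->] := circle_exp_surj z.
pose k := Num.floor (t - a); exists (t - k%:~R).
  have := floor_itv (t - a) (R := R); rewrite -/k intrD => /andP[]; lra.
case: k => k; first by rewrite circle_expBn.
by rewrite NegzE mulrNz opprK circle_expDn.
Qed.

Lemma compact_circle_exp (a b : R) : compact (@circle_exp R @` `[a, b]).
Proof.
apply: continuous_compact; last exact: segment_compact.
by apply: continuous_subspaceT => x; exact: continuous_circle_exp.
Qed.

(** The ends are real arguments, so an arc across the point 1 is written with [a < 1 < b]. *)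
Definition arc (a b : R) : set (circle R) := @circle_exp R @` `]a, b[.

(** Every point has an argument in [[a, a + 1[], and arguments at distance less than 1 are unique.
    The right-hand side is the complement of a compact set, whence [open_arc]. *)
Lemma arcE (a b : R) : a < b -> b <= a + 1 ->
  arc a b = ~` (@circle_exp R @` `[b, a + 1]).
Proof.
move=> ab ba; apply/seteqP; split => [_ [x /= + <-] [y /= + yx]|z nz].
  rewrite !in_itv /= => /andP[ax xb] /andP[yb ya].
  have xy : x = y by apply: circle_exp_inj; rewrite // ltr_norml; lra.
  by move: xb; rewrite ltNge xy yb.
have [t /andP[at_ ta] zt] := circle_exp_surj_itv a z.
exists t => //=; rewrite in_itv /=; apply/andP; split; rewrite ltNge; apply/negP => h.
  apply: nz; exists (a + 1) => /=; first by rewrite in_itv /= ba lexx.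
  by rewrite circle_exp_per zt; congr circle_exp; apply/eqP; rewrite eq_le at_.
by apply: nz; exists t => //=; rewrite in_itv /= h ltW.
Qed.

Lemma open_arc (a b : R) : a < b -> b <= a + 1 -> open (arc a b).
Proof.
move=> ab ba; rewrite arcE //; apply: closed_openC; apply: compact_closed.
  exact: circle_hausdorff.
exact: compact_circle_exp.
Qed.

Lemma connected_arc (a b : R) : connected (arc a b).
Proof.
apply: connected_continuous_connected.
  exact/connected_intervalP/interval_is_interval.
by apply: continuous_subspaceT => x; exact: continuous_circle_exp.
Qed.

(** The component [K] of [z] meets the arc in a relatively open set. As the two ends lie in [F],
    outside [K], this is also the trace on [K] of the closed arc, so it is relatively closed and
    equals the connected set [K]. *)
Lemma arc_component (a b : R) F z : a < b -> b <= a + 1 ->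
  F (circle_exp a) -> F (circle_exp b) -> arc a b `<=` ~` F -> arc a b z ->
  connected_component (~` F) z = arc a b.
Proof.
move=> ab ba Fa Fb aF az; apply/seteqP; split; last first.
  by apply: connected_component_max => //; exact: connected_arc.
have KF := @connected_component_sub _ (~` F) z.
set K := connected_component _ _ in KF *.
have <- : K `&` arc a b = K; last by move=> ? [].
apply: component_connected.
- by exists z; split => //; apply/connected_component_refl/aF.
- by exists (arc a b) => //; exact: open_arc.
exists (@circle_exp R @` `[a, b]).
  apply: compact_closed; [exact: circle_hausdorff|exact: compact_circle_exp].
apply/seteqP; split => w [Kw [x /= + xw]]; rewrite in_itv /= => /andP[ax xb].
  by split => //; exists x => //=; rewrite in_itv /= !ltW.
split => //; exists x => //=; rewrite in_itv /= !lt_neqAle ax xb !andbT.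
by apply/andP; split; apply/eqP => e; apply: (KF _ Kw); rewrite -xw -?e // e.
Qed.

End circle_topology.

(** * Arguments in [[0, 1[], Haar measure of arcs, preimages of null sets *)

Section circle_measure.
Variable R : realType.
Implicit Types (F : set (circle R)) (x a b : R).

(** The half-open interval makes arguments unique. By definition of [haar], the Haar measure of [F]
    is the Lebesgue measure of [lift F]. *)
Definition lift F : set R := @circle_exp R @^-1` F `&` `[0, 1[.

Lemma lift_itv F : lift F `<=` `[0, 1].
Proof. by move=> x [_] /=; rewrite !in_itv /= => /andP[-> /ltW ->]. Qed.

Lemma measurable_lift F : measurable F -> measurable (lift F : set (measurableTypeR R)).
Proof.
move=> mF; apply: measurableI => //.
by rewrite -[X in measurable X]setTI; exact: measurable_circle_exp.
Qed.

Lemma haar_arc a b : 0 <= a -> a < b -> b <= 1 -> haar (arc a b) = (b - a)%:E.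
Proof.
move=> a0 ab b1; transitivity (@lebesgue_measure R `]a, b[%classic); last first.
  by rewrite lebesgue_measure_itv /= lte_fin ab.
congr lebesgue_measure; apply/seteqP; split => [x [[y /= + yx]]|x /=].
  rewrite !in_itv /= => /andP[ay yb] /andP[x0 x1].
  have -> : x = y by apply: circle_exp_inj; rewrite // ltr_norml; lra.
  by rewrite ay.
rewrite !in_itv /= => /andP[ax xb]; split; last by lra.
by exists x => //=; rewrite in_itv /= ax.
Qed.

(** The arc misses exactly one point, which is null. *)
Lemma haar_arc1 x : 0 <= x < 1 -> haar (arc x (x + 1)) = 1%E.
Proof.
move=> x01; have xx1 : x < x + 1 by rewrite ltrDl.
have sE : @circle_exp R @` `[x + 1, x + 1] = [set circle_exp x].
  rewrite set_itv1; apply/seteqP; split => [_ [_ -> <-]|_ ->] /=.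
    exact: circle_exp_per.
  by exists (x + 1) => //; exact: circle_exp_per.
rewrite arcE // sE probability_setC; last first.
  apply: closed_measurable_circle; rewrite -sE.
  by apply: compact_closed; [exact: circle_hausdorff|exact: compact_circle_exp].
suff e0 : haar [set circle_exp x] = 0%E by rewrite [X in (1 - X)%E]e0 sube0.
transitivity (@lebesgue_measure R [set x]); last exact: lebesgue_measure_set1.
congr lebesgue_measure; apply/seteqP; split => [y [/= xy]|y -> /=]; last first.
  by split => //; rewrite in_itv.
rewrite in_itv /= => y01; apply: circle_exp_inj; rewrite // ltr_norml.
by move: x01 y01; lra.
Qed.

(** The pushforward of Lebesgue measure along [a * x - b], multiplied by [a], agrees with Lebesgue
    measure on half-open intervals, hence everywhere. *)
Lemma lebesgue_measure_affine0 a b (A : set (measurableTypeR R)) :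
  0 < a -> measurable A ->
  lebesgue_measure A = 0%E -> lebesgue_measure [set x | A (a * x - b)] = 0%E.
Proof.
move=> a0 mA A0; pose f (x : measurableTypeR R) : measurableTypeR R := a * x - b.
have mf : measurable_fun setT f.
  apply: measurable_funB; last exact: measurable_cst.
  by apply: measurable_funM => //; exact: measurable_cst.
pose p := measure_function_pushforward__canonical__measure_function_Measure
  (@lebesgue_measure R) mf.
pose nu := mscale (NngNum (ltW a0)) p.
have nuE X : ocitv X -> lebesgue_measure X = nu X.
  move=> [[x y]] _ <- /=; rewrite /nu /mscale /= /pushforward.
  rewrite (_ : _ @^-1` _ = `](x + b) / a, (y + b) / a]%classic); last first.
    apply/seteqP; split => t /=; rewrite !in_itv /= /f ltrBrDr lerBlDr;
      by rewrite ltr_pdivrMr // ler_pdivlMr // [t * a]mulrC.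
  rewrite !lebesgue_measure_itv /= !lte_fin ltr_pM2r ?invr_gt0 // ltrD2r.
  case: ifPn => _; last by rewrite mule0.
  rewrite -!EFinD -EFinM; congr EFin; field.
  exact: lt0r_neq0.
have := lebesgue_measure_unique nuE mA.
rewrite A0 /nu /mscale /= => /esym /eqP; rewrite mule_eq0 eqe gt_eqF //=.
by move/eqP.
Qed.

(** Take for [j] the integer part of [n * x]: then [n * x - j] lies in [[0, 1[] and is still an
    argument of the power, and [x < 1] forces [j < n]. *)
Lemma lift_circle_pow F n : (0 < n)%N ->
  lift (circle_pow n @^-1` F) `<=`
  \bigcup_(j < n) (`[0, 1] `&` [set x | lift F (n%:R * x - j%:R)]).
Proof.
move=> n0 x Fx; have [/= Fnx] := Fx; rewrite in_itv /= => /andP[x0 x1].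
rewrite circle_pow_exp in Fnx.
have nx0 : 0 <= n%:R * x by rewrite mulr_ge0.
have /andP[jx xj] := truncn_itv nx0; exists (Num.truncn (n%:R * x)) => /=.
  rewrite -(ltr_nat R); apply: le_lt_trans jx _.
  by rewrite gtr_pMr // ltr0n.
split; first exact: lift_itv Fx.
split => /=; first by rewrite circle_expBn.
by rewrite in_itv /= subr_ge0 jx /= ltrBlDl natr1.
Qed.

Lemma haar_circle_pow0 F n : (0 < n)%N -> measurable F -> haar F = 0%E ->
  haar (circle_pow n @^-1` F) = 0%E.
Proof.
move=> n0 mF F0; apply/eqP; rewrite eq_le measure_ge0 andbT.
have mn j : measurable ([set x | lift F (n%:R * x - j%:R)] : set (measurableTypeR R)).
  rewrite -[X in measurable X]setTI.
  have mf : measurable_fun setT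
      ((fun x => n%:R * x - j%:R) : measurableTypeR R -> measurableTypeR R).
    apply: measurable_funB; last exact: measurable_cst.
    by apply: measurable_funM => //; exact: measurable_cst.
  exact: mf (measurable_lift mF).
have mpow : measurable (circle_pow n @^-1` F).
  by rewrite -[X in measurable X]setTI; exact: measurable_circle_pow.
(* Letting [j] range over all naturals still covers the preimage, by a countable union of null
   sets. *)
have <- : @lebesgue_measure R (\bigcup_j [set x | lift F (n%:R * x - j%:R)]) = 0%E.
  apply/negligibleP; first exact: bigcup_measurable.
  apply: negligible_bigcup => j; apply/negligibleP => //.
  by apply: lebesgue_measure_affine0 => //; [rewrite ltr0n|exact: measurable_lift].
apply: le_measure; rewrite ?inE.
- exact: measurable_lift.
- exact: bigcup_measurable.
- by move=> x /(lift_circle_pow n0)[j _ [_ Fx]]; exists j.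
Qed.

End circle_measure.

(** * Entropy in terms of gap sums; stability of Carleson sets *)

Section finite_entropy.
Variables (R : realType) (kappa : R -> R).
Hypothesis kappa_homo : {in `[0, 1] &, {homo kappa : x y / x <= y}}.
Hypotheses (kappa0 : kappa 0 = 0) (kappa1 : kappa 1 = 1).
Implicit Types (E F : set (circle R)) (t p : seq R) (x : R).

Lemma ex_nth_itv (u : nat -> R) m x : u 0%N <= x -> x < u m ->
  exists2 i, (i < m)%N & u i <= x < u i.+1.
Proof.
elim: m => [u0 x0|m IH u0 xm]; first by have := le_lt_trans u0 x0; rewrite ltxx.
have [um|um] := leP (u m) x; first by exists m => //; rewrite um.
by have [i im ui] := IH u0 um; exists i => //; rewrite ltnS ltnW.
Qed.

(** Closing the sequence with [x + 1], which has the same image as [x], lets every arc, the last one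
    included, run between consecutive entries. Injectivity allows the entropy to be summed over
    indices. *)
Lemma components_arcs (x : R) p : sorted <%R (rcons (x :: p) (x + 1)) ->
  let u := nth 0 (rcons (x :: p) (x + 1)) in
  set_inj `I_(size p).+1 (fun i => arc (u i) (u i.+1)) /\
  components (~` (@circle_exp R @` [set` x :: p])) =
    (fun i => arc (u i) (u i.+1)) @` `I_(size p).+1.
Proof.
move=> st u; set A := fun i => arc (u i) (u i.+1).
set E := @circle_exp R @` _.
have sz : size (rcons (x :: p) (x + 1)) = (size p).+2 by rewrite size_rcons.
have le_u i j : (i <= j)%N -> (j <= (size p).+1)%N -> u i <= u j.
  move=> ij jp; rewrite (lt_sorted_leq_nth _ st) // inE sz ltnS //.
  exact: leq_trans jp.
have lt_u i j : (i < j)%N -> (j <= (size p).+1)%N -> u i < u j.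
  move=> ij jp; rewrite (lt_sorted_ltn_nth _ st) // inE sz ltnS //.
  exact: leq_trans (ltnW ij) jp.
have u0 : u 0%N = x by [].
have um : u (size p).+1 = x + 1 by rewrite /u nth_rcons /= ltnn eqxx.
have u_p k : (k < (size p).+1)%N -> u k = (x :: p)`_k.
  by move=> kp; rewrite /u nth_rcons /= kp.
have u_itv k : (k <= (size p).+1)%N -> x <= u k <= x + 1.
  by move=> kp; rewrite -um -{1}u0 !le_u.
have EP k : (k <= (size p).+1)%N -> E (circle_exp (u k)).
  rewrite leq_eqVlt => /orP[/eqP ->|kp].
    by rewrite um circle_exp_per; exists x => //=; rewrite mem_head.
  by exists (u k) => //=; rewrite u_p // mem_nth.
(* A common point would have the arguments [s], strictly inside a gap, and [u k], both in [[x, x +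
   1[]; they would coincide, but no entry lies strictly inside a gap. *)
have AE i : (i < (size p).+1)%N -> A i `<=` ~` E.
  move=> ip _ [s /= + <-] [y /= /(nthP 0)[k kp <-]]; rewrite in_itv /= => /andP[us su] ys.
  have kp' : (k < (size p).+1)%N by [].
  have yk : u k < x + 1 by rewrite -um lt_u.
  have := u_itv k (ltnW kp'); have := u_itv i (ltnW ip); have := u_itv i.+1 ip.
  move=> h1 h2 h3.
  have e : u k = s.
    by rewrite u_p //; apply: circle_exp_inj; rewrite // -u_p // ltr_norml; lra.
  have [ki|ik] := leqP k i.
    by move: us; rewrite ltNge -e le_u // ltnW.
  by move: su; rewrite ltNge -e le_u // ltnW.
have cover z : ~ E z -> exists2 i, (i < (size p).+1)%N & A i z.
  move=> nEz; have [s /andP[xs sx] zs] := circle_exp_surj_itv x z.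
  have [||i ip /andP[us su]] := @ex_nth_itv u (size p).+1 s; rewrite ?um //.
  exists i => //; exists s => //=; rewrite in_itv /= su andbT lt_neqAle us andbT.
  by apply/eqP => e; apply: nEz; rewrite zs -e; apply: EP; exact: ltnW.
have le1 i : (i < (size p).+1)%N -> u i.+1 <= u i + 1.
  by move=> ip; have := u_itv _ (ltnW ip); have := u_itv _ ip; lra.
have AC i z : (i < (size p).+1)%N -> A i z -> connected_component (~` E) z = A i.
  move=> ip Az; apply: arc_component => //.
  - exact: lt_u.
  - exact: le1.
  - by apply: EP; exact: ltnW.
  - exact: EP.
  - exact: AE.
have A0 i : (i < (size p).+1)%N -> exists2 s, u i < s < u i.+1 & A i (circle_exp s).
  move=> ip; have := lt_u _ _ (ltnSn i) ip => uu.
  pose c := (u i + u i.+1) / 2; have c_itv : u i < c < u i.+1 by rewrite /c; lra.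
  by exists c => //; exists c => //=; rewrite in_itv.
split.
  (* A point common to both arcs has one argument in [[x, x + 1[], which cannot lie both before
     [u i.+1] and after [u j]. *)
  have wlog_inj i j : (i < j)%N -> (j < (size p).+1)%N -> A i = A j -> False.
    move=> ij jp Aij; have ip := ltn_trans ij jp.
    have [s us] := A0 _ ip; rewrite Aij => -[s' /=]; rewrite in_itv /= => us' es.
    have := u_itv _ (ltnW ip); have := u_itv _ ip.
    have := u_itv _ (ltnW jp); have := u_itv _ jp.
    move=> h1 h2 h3 h4.
    have ss : s' = s by apply: circle_exp_inj; rewrite // ltr_norml; lra.
    by have := le_u _ _ ij (ltnW jp); move: us us'; rewrite ss; lra.
  move=> i j; rewrite !inE /= => ip jp Aij.
  by case: (ltngtP i j) => // ij; [case: (wlog_inj i j)|case: (wlog_inj j i)].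
apply/seteqP; split => [_ [z nEz <-]|_ [i ip <-]].
  by have [i ip Az] := cover z nEz; exists i => //; rewrite (AC i).
have [s _ As] := A0 _ ip; exists (circle_exp s); [exact: AE As|exact: AC].
Qed.

Lemma kappa_haar_itv E : measurable E -> 0 <= kappa (fine (haar E)) <= 1.
Proof.
move=> mE; have E01 : 0 <= fine (haar E) <= 1.
  rewrite fine_ge0 //=.
  by rewrite -lee_fin fineK ?fin_num_measure // probability_le1.
by rewrite kappa_ge0 // kappa_le1.
Qed.

(** The last arc may run past 1, outside the scope of [haar_arc], so its term is left unevaluated;
    all other arcs have the gap as length. *)
Lemma entropy_finiteE x p : sorted <%R (x :: p) -> {in x :: p, forall y, 0 <= y < 1} ->
  entropy_finite kappa (@circle_exp R @` [set` x :: p]) =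
  (gap_sum kappa (x :: p) + kappa (fine (haar (arc (last x p) (x + 1)))))%:E.
Proof.
move=> st p01; have x01 : 0 <= x < 1 by apply: p01; rewrite mem_head.
have lx : last x p < x + 1 by have := p01 _ (mem_last x p); lra.
have stu : sorted <%R (rcons (x :: p) (x + 1)).
  by move: st; rewrite /= rcons_path => ->.
have [Ainj AE] := components_arcs stu.
rewrite /entropy_finite; case: asboolP => [E0|_].
  have : (@circle_exp R @` [set` x :: p]) (circle_exp x).
    by exists x => //=; rewrite mem_head.
  by rewrite E0.
set u := nth 0 _ in Ainj AE.
have sz : size (rcons (x :: p) (x + 1)) = (size p).+2 by rewrite size_rcons.
have lt_u i : (i < (size p).+1)%N -> u i < u i.+1.
  by move=> ip; apply/(sortedP 0 stu); rewrite sz ltnS.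
have u_p k : (k < (size p).+1)%N -> u k = (x :: p)`_k.
  by move=> kp; rewrite /u nth_rcons /= kp.
have u01 k : (k < (size p).+1)%N -> 0 <= u k < 1.
  by move=> kp; rewrite u_p //; apply: p01; exact: mem_nth.
have ux k : (k < (size p).+2)%N -> x <= u k <= x + 1.
  rewrite ltnS leq_eqVlt => /orP[/eqP ->|kp].
    by rewrite /u nth_rcons /= ltnn eqxx lerDl ler01 lexx.
  have xu : u 0%N <= u k by rewrite (lt_sorted_leq_nth 0 stu) // inE sz ltnS ltnW.
  have := u01 _ kp; rewrite -[x]/(u 0%N); move: xu x01; rewrite -[x]/(u 0%N); lra.
have mA i : (i < (size p).+1)%N -> measurable (arc (u i) (u i.+1)).
  move=> ip; apply: open_measurable_circle; apply: open_arc; first exact: lt_u.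
  by have := ux i (ltnW ip); have := ux i.+1 ip; lra.
rewrite AE esum_image // esum_fset; last 2 first.
- exact: finite_II.
- by move=> i; rewrite inE /= lee_fin => ip; have /andP[] := kappa_haar_itv (mA _ ip).
rewrite -fsbig_ord sumEFin big_ord_recr /=; congr (_ + _)%:E.
  apply: eq_bigr => i _; have ip := ltn_ord i.
  have i1p : (i < (size p).+1)%N by rewrite ltnS ltnW.
  rewrite haar_arc /=; first by rewrite !u_p.
  - by case/andP: (u01 _ i1p).
  - exact: lt_u.
  - by case/andP: (u01 i.+1 ip) => _ /ltW.
congr (kappa (fine (haar (arc _ _)))); last by rewrite /u nth_rcons /= ltnn eqxx.
by rewrite u_p // nth_last.
Qed.

Lemma kappa_last_arc_itv x p : sorted <%R (x :: p) -> {in x :: p, forall y, 0 <= y < 1} ->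
  0 <= kappa (fine (haar (arc (last x p) (x + 1)))) <= 1.
Proof.
move=> st p01; apply: kappa_haar_itv.
have x01 : 0 <= x < 1 by apply: p01; rewrite mem_head.
have l01 := p01 _ (mem_last x p).
apply: open_measurable_circle; apply: open_arc; first by lra.
have : x <= last x p.
  have := mem_last x p; rewrite inE => /orP[/eqP -> //|lp].
  by have /allP/(_ _ lp)/ltW := order_path_min lt_trans st.
by lra.
Qed.

Lemma entropy_finite0 : entropy_finite kappa set0 = 0%E.
Proof. by rewrite /entropy_finite; case: asboolP. Qed.

Lemma entropy_ge0 F : (0 <= entropy kappa F)%E.
Proof.
apply: ereal_sup_ubound; exists set0; last exact: entropy_finite0.
by split; [exact: finite_set0|exact: sub0set].
Qed.

(** This is [entropy_finiteE] with the nonnegative term of the last arc dropped. *)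
Lemma gap_sum_le_entropy F t : sorted <%R t -> (forall x, x \in t -> lift F x) ->
  ((gap_sum kappa t)%:E <= entropy kappa F)%E.
Proof.
move=> st tF.
case: t st tF => [_ _|x p st tF].
  by rewrite /gap_sum big_ord0 entropy_ge0.
have p01 : {in x :: p, forall y, 0 <= y < 1} by move=> y /tF[_]; rewrite /= in_itv.
apply: le_trans (_ : entropy_finite kappa (@circle_exp R @` [set` x :: p]) <= _)%E.
  by rewrite entropy_finiteE // lee_fin lerDl; case/andP: (kappa_last_arc_itv st p01).
apply: ereal_sup_ubound; exists (@circle_exp R @` [set` x :: p]) => //; split.
  by apply: finite_image; apply/finite_seqP; exists (x :: p).
by move=> _ [y /= /tF[? _] <-].
Qed.

(** Brings a finite set into the form treated by [entropy_finiteE]: choose arguments, remove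
    repetitions, sort. *)
Lemma finite_lift F E : E `<=` F -> finite_set E -> exists t, [/\ sorted <%R t,
  forall x, x \in t -> lift F x & E = @circle_exp R @` [set` t]].
Proof.
move=> EF /finite_seqP[s Es].
have /choice[g gP] : forall z : circle R, exists r : R, 0 <= r < 1 /\ circle_exp r = z.
  by move=> z; have [r r01 ->] := circle_exp_surj_itv 0 z; exists r; rewrite -[1]add0r.
exists (sort <=%R (undup (map g s))); split.
- by rewrite sort_lt_sorted undup_uniq.
- move=> x; rewrite mem_sort mem_undup => /mapP[z zs ->].
  have [gz01 gz] := gP z; split; last by rewrite /= in_itv.
  by rewrite /= gz; apply: EF; rewrite Es.
- rewrite Es; apply/seteqP; split => [z /= zs|_ [x /= + <-]].
    by exists (g z); [rewrite /= mem_sort mem_undup map_f|case: (gP z)].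
  by rewrite mem_sort mem_undup => /mapP[z zs ->]; case: (gP z) => _ ->.
Qed.

(** The last arc, absent from gap sums, contributes at most 1, so a bound [C] on gap sums gives
    [C + 1] for the entropy. *)
Lemma entropy_ltyP F : (entropy kappa F < +oo)%E <-> gap_bounded kappa (lift F).
Proof.
split=> [Foo|[C HC]].
  exists (fine (entropy kappa F)) => t st tF.
  by rewrite -lee_fin fineK ?ge0_fin_numE ?entropy_ge0 // gap_sum_le_entropy.
(* Serves the empty subset, whose entropy is 0. *)
have C0 : 0 <= C by have := HC [::] isT; rewrite /gap_sum big_ord0; apply.
apply: le_lt_trans (ltry (C + 1)); apply: ge_ereal_sup => _ [E [finE EF] <-].
have [[|x p] [st tF ->]] := finite_lift EF finE.
  rewrite (_ : _ @` _ = set0) ?entropy_finite0 ?lee_fin ?addr_ge0 //.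
  by apply/seteqP; split => z // -[].
have p01 : {in x :: p, forall y, 0 <= y < 1} by move=> y /tF[_]; rewrite /= in_itv.
rewrite entropy_finiteE // lee_fin lerD ?HC //.
by case/andP: (kappa_last_arc_itv st p01).
Qed.

Lemma entropy_ge1 F : F !=set0 -> (1 <= entropy kappa F)%E.
Proof.
move=> [z Fz]; have [x x01 zx] := circle_exp_surj_itv 0 z; rewrite add0r in x01.
apply: ereal_sup_ubound; exists (@circle_exp R @` [set` [:: x]]).
  split; first by apply: finite_image; apply/finite_seqP; exists [:: x].
  by move=> _ [y /= + <-]; rewrite inE => /eqP ->; rewrite -zx.
rewrite entropy_finiteE //; last by move=> y; rewrite inE => /eqP ->.
by rewrite /= haar_arc1 // gap_sum1 add0r kappa1.
Qed.

Lemma carlesonU E F : carleson kappa E -> carleson kappa F -> carleson kappa (E `|` F).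
Proof.
move=> [cE E0 /entropy_ltyP bE] [cF F0 /entropy_ltyP bF]; split; first exact: closedU.
  apply/eqP; rewrite eq_le measure_ge0 andbT -(adde0 0%E) -{1}E0 -F0.
  by apply: measureU2; exact: closed_measurable_circle.
apply/entropy_ltyP; rewrite /lift preimage_setU setIUl.
by apply: gap_boundedU => //; rewrite subUset; split; exact: lift_itv.
Qed.

Lemma carleson0 : carleson kappa set0.
Proof.
split; [exact: closed0|exact: measure0|apply/entropy_ltyP].
by rewrite /lift preimage_set0 set0I; exact: gap_bounded0.
Qed.

Lemma carleson_circle_pow n F : (0 < n)%N -> carleson kappa F ->
  carleson kappa (circle_pow n @^-1` F).
Proof.
move=> n0 [cF F0 /entropy_ltyP bF]; split.
- by apply: closed_comp cF => z _; exact: continuous_circle_pow.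
- by apply: haar_circle_pow0 => //; exact: closed_measurable_circle.
apply/entropy_ltyP; apply: gap_boundedS (lift_circle_pow n0) _.
apply: gap_bounded_bigcup => // j jn.
apply: gap_boundedS (_ : _ `<=` [set x | lift F (n%:R * x - j%:R)]) _.
  exact: subIsetr.
by apply: gap_bounded_affine => //; [rewrite ler1n|exact: lift_itv].
Qed.

End finite_entropy.

Lemma generated_monoid_submonoid (G : set nat) : mul_submonoid (generated_monoid G).
Proof.
split=> [A [[A1 _] _] //|m n Gm Gn A AP].
by have [[_ AM] _] := AP; apply: AM; [exact: Gm|exact: Gn].
Qed.

(** The positive integers form a submonoid, so minimality suffices. *)
Lemma generated_monoid_gt0 (G : set nat) n : (forall m, G m -> (0 < m)%N) ->
  generated_monoid G n -> (0 < n)%N.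
Proof.
move=> G0 /(_ [set m | (0 < m)%N]); apply; split => //.
by split=> // a b /= a0 b0; rewrite muln_gt0 a0.
Qed.

(** * Ergodicity and the union of preimages of a charged set *)

Section ergodic_saturation.
Variables (R : realType) (S : set nat) (mu : {finite_measure set (circle R) -> \bar R}).
Hypotheses (SM : mul_submonoid S) (mu_inv : invariant_measure S mu)
  (mu_erg : ergodic_measure S mu).

Lemma ergodic_preimages_full (F : set (circle R)) : measurable F -> (0 < mu F)%E ->
  mu (~` \bigcup_(n in S) (circle_pow n @^-1` F)) = 0%E.
Proof.
move=> mF F0; have [S1 SMul] := SM; set G := \bigcup_(n in S) _.
have mpow n (A : set (circle R)) : measurable A -> measurable (circle_pow n @^-1` A).
  by move=> mA; rewrite -[X in measurable X]setTI; exact: measurable_circle_pow.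
have pow1 (z : circle R) : circle_pow 1 z = z by apply/val_inj; rewrite /= expr1.
have mG : measurable G by apply: bigcup_measurable => n _; exact: mpow.
have FG : F `<=` G by move=> z Fz; exists 1%N => //=; rewrite pow1.
have GS n : S n -> circle_pow n @^-1` G `<=` G.
  by move=> Sn z [m Sm /= Fz]; exists (n * m)%N; [exact: SMul|rewrite /= circle_powM].
pose C := \bigcap_(k in S) (circle_pow k @^-1` G).
have mC : measurable C.
  by apply: bigcap_measurable => [|k _]; [exists 1%N|exact: mpow].
have CG : C `<=` G by move=> z /(_ _ S1); rewrite /= pow1.
(* One inclusion combines commutativity of the powers with [GS]; the other uses that [S] is closed
   under products. *)
have C_inv n : S n -> circle_pow n @^-1` C = C.
  move=> Sn; apply/seteqP; split => z Cz k Sk /=.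
    by apply: (GS n) => //=; rewrite -circle_powM mulnC circle_powM; exact: Cz.
  by rewrite -circle_powM; apply: Cz; exact: SMul.
have GC0 : mu (G `\` C) = 0%E.
  apply/negligibleP; first exact: measurableD.
  (* A countable union of differences, each null because [phi_k^-1 G] is a subset of [G] with the
     same finite measure. *)
  have -> : G `\` C = \bigcup_k (if k \in S then G `\` (circle_pow k @^-1` G) else set0).
    rewrite -bigcup_mkcond; apply/seteqP; split => z.
      by move=> [Gz /existsNP[k /not_implyP[Sk kz]]]; exists k.
    by move=> [k Sk [Gz kz]]; split => // /(_ k Sk).
  apply: negligible_bigcup => k; case: ifPn => [|_]; last exact: negligible_set0.
  rewrite inE => Sk; apply/negligibleP; first by apply: measurableD => //; exact: mpow.
  rewrite measureD //; [|exact: mpow|by rewrite ltey_eq fin_num_measure].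
  rewrite (setIidr (GS _ Sk)) [X in (_ - X)%E](mu_inv Sk mG).
  by rewrite subee // fin_num_measure.
(* Up to a null set [C] is [G], which contains [F]; this rules out the null alternative of
   ergodicity. *)
have C_pos : (0 < mu C)%E.
  apply: lt_le_trans F0 _; apply: le_trans (le_measure mu _ _ FG) _; rewrite ?inE //.
  rewrite -(setDKU CG) setUC; apply: le_trans (measureU2 _ mC (measurableD mG mC)) _.
  by rewrite [X in (_ + X)%E]GC0 adde0.
have [C0|CT] := mu_erg mC C_inv; first by rewrite C0 ltxx in C_pos.
apply/eqP; rewrite eq_le measure_ge0 andbT.
rewrite (le_trans (le_measure mu _ _ (subsetC CG))) ?inE //; try exact: measurableC.
rewrite -setTD measureD //; last by rewrite ltey_eq fin_num_measure.
by rewrite setTI [X in (_ - X)%E]CT subee // fin_num_measure.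
Qed.

End ergodic_saturation.

(** * Exhaustion of [mu] and the entropy bound *)

Theorem proposition48 (R : realType) (kappa : R -> R)
  (kappa_continuous : {within `[0, 1], continuous kappa})
  (kappa_nondecreasing : {in `[0, 1] &, {homo kappa : x y / x <= y}})
  (kappa_concave :
    convex_function (`[0, 1] : set (convex_lmodType R^o)) (fun x => - kappa x))
  (kappa0 : kappa 0 = 0) (kappa1 : kappa 1 = 1)
  (s : nat) (s_ge1 : (1 <= s)%N) (N : 'I_s -> nat)
  (N_ge2 : forall i, (2 <= N i)%N)
  (N_coprime : forall i j, i != j -> coprime (N i) (N j))
  (mu : {finite_measure set (circle R) -> \bar R})
  (mu_invariant : invariant_measure (generated_monoid (range N)) mu)
  (mu_ergodic : ergodic_measure (generated_monoid (range N)) mu)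
  (mu_charges : exists2 F, carleson kappa F & (0 < mu F)%E) :
  thin kappa mu.
Proof.
set S := generated_monoid _ in mu_invariant mu_ergodic.
have SM : mul_submonoid S by exact: generated_monoid_submonoid.
have S_gt0 n : S n -> (0 < n)%N.
  by apply: generated_monoid_gt0 => _ [i _ <-]; exact: leq_trans (N_ge2 i).
have [F CF F0] := mu_charges; split; last first.
  exists (fine (mu setT)) => [|E CE]; first exact: fine_ge0.
  have mE : measurable E by case: CE => cE _ _; exact: closed_measurable_circle.
  rewrite fineK ?fin_num_measure //.
  (* The empty set has entropy 0, so the lower bound 1 is available for nonempty sets alone. *)
  have [->|/set0P E0] := eqVneq E set0.
    by rewrite measure0 mule_ge0 // entropy_ge0.
  apply: le_trans (_ : mu setT * 1 <= _)%E; first by rewrite mule1 le_measure ?inE.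
  by rewrite lee_wpmul2l // entropy_ge1.
have mF : measurable F by case: CF => cF _ _; exact: closed_measurable_circle.
(* Filling the indices outside [S] with the empty Carleson set turns the union over [S] into a limit
   of increasing finite unions. *)
pose P n := if n \in S then circle_pow n @^-1` F else set0.
pose Fs n := \big[setU/set0]_(i < n.+1) P i.
have CP n : carleson kappa (P n).
  rewrite /P; case: ifPn => [|_]; last exact: carleson0.
  by rewrite inE => /S_gt0 n0; exact: carleson_circle_pow.
have CFs n : carleson kappa (Fs n).
  by apply: (big_ind (carleson kappa)) => //; [exact: carleson0|exact: carlesonU].
have mFs n : measurable (Fs n).
  by case: (CFs n) => cF _ _; exact: closed_measurable_circle.
have FsE : \bigcup_n Fs n = \bigcup_(n in S) (circle_pow n @^-1` F).
  by rewrite bigcup_bigsetU_bigcup [RHS]bigcup_mkcond.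
exists Fs; split => // [n|B mB]; first by rewrite /Fs [X in _ `<=` X]big_ord_recr; left.
have mG : measurable (\bigcup_n Fs n) by exact: bigcup_measurable.
(* The part of [B] outside the union is null by [ergodic_preimages_full]; continuity from below then
   gives the limit. *)
have muB : mu B = mu (\bigcup_n (B `&` Fs n)).
  rewrite -setI_bigcupr -(setIT B) -[in LHS](setUv (\bigcup_n Fs n)) setIUr.
  rewrite measureU.
  - rewrite setIT [X in (_ + X)%E](_ : _ = 0%E) ?adde0 //.
    apply/eqP; rewrite eq_le measure_ge0 andbT.
    rewrite -(ergodic_preimages_full SM mu_invariant mu_ergodic mF F0) -FsE le_measure ?inE //.
    + by apply: measurableI => //; exact: measurableC.
    + exact: measurableC.
  - exact: measurableI.
  - by apply: measurableI => //; exact: measurableC.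
  - by rewrite setIACA setICr setI0.
rewrite [X in _ --> X]muB; apply: nondecreasing_cvg_mu.
- by move=> n; exact: measurableI.
- by apply: bigcup_measurable => n _; exact: measurableI.
- move=> m n mn; apply/subsetPset; apply: setIS.
  exact: (@subset_bigsetU _ P m.+1 n.+1).
Qed.
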